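(* For each of the two metamaterials (Kagome and Rotating Squares) there exists $\eta_0>0$ such that for every $\eta$ with $0<\eta<\eta_0$ and every $\lambda\in\mathbb R^{2\times2}$, the effective energy density satisfies $\overline W^\eta(\lambda)=0$ if and only if $\lambda$ is an isotropic compression, i.e. $\lambda=cR$ with $0\le c\le1$ and $R\in SO(2)$.
   Context: Kagome metamaterial. Lattice vectors $v_1=(2,0)^T$, $v_2=(1,\sqrt3)^T$. Points $O=(0,0)$, $A=(\tfrac12,\tfrac{\sqrt3}{2})$, $B=(-\tfrac12,\tfrac{\sqrt3}{2})$, $C=(-\tfrac12,-\tfrac{\sqrt3}{2})$, $D=(\tfrac12,-\tfrac{\sqrt3}{2})$, $E=(\tfrac32,-\tfrac{\sqrt3}{2})$, $F=(\tfrac32,\tfrac{\sqrt3}{2})$. The unit cell $U$ is the rectangle with vertices $B,C,E,F$; the basic set of nodes is $V=\{A,O,D\}$. The spring energy is $$E_{\rm spr}(u,U)=\sum_{(P,Q)}\big(|u(P)-u(Q)|-|P-Q|\big)^2,$$ the sum being over the six springs $AO,BO,CO,DO,AF,DE$. The penalized triangles are $\Delta AOB$ and $\Delta COD$. Rotating Squares metamaterial. Lattice vectors $v_1=(2,0)^T$, $v_2=(0,2)^T$. Points $A=(-1,1)$, $B=(0,1)$, $C=(1,1)$, $D=(-1,0)$, $O=(0,0)$, $E=(1,0)$, $F=(-1,-1)$, $G=(0,-1)$, $H=(1,-1)$. The unit cell $U$ is the square with vertices $A,C,H,F$; the basic set of nodes is $V=\{O,A,B,D\}$. The spring energy is $$E_{\rm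 spr}(u,U)=\sum_{(P,Q)}c_{PQ}\big(|u(P)-u(Q)|-|P-Q|\big)^2,$$ the sum being over the ten springs $AB,AO,AD,BC,BO,DO,EO,DF,OG,OH$, with $c_{PQ}=2$ for the diagonal springs $AO,OH$ and $c_{PQ}=1$ for the other eight. The penalized triangles are $\Delta AOB,\Delta AOD,\Delta EOH,\Delta GOH$. For both: the set of nodes is $\mathcal V=\bigcup_{\alpha_1,\alpha_2\in\mathbb Z}(V+\alpha_1v_1+\alpha_2v_2)$. A deformation is a function $u:\mathcal V\to\mathbb R^2$. For a triangle $T$ with vertices in $\mathcal V$, $Du|_T$ is the (constant) gradient of the affine interpolant of $u$ on $T$, and $|T|$ is its area. For $\eta>0$ put $f^\eta(t)=1/\eta$ for $t\le 0$, $f^\eta(t)=0$ for $t>0$, and $$E^\eta(u,U)=E_{\rm spr}(u,U)+\sum_{T}|T|\,f^\eta(\det Du|_T),$$ the sum being over the penalized triangles. For $\alpha=\alpha_1v_1+\alpha_2v_2$ with $\alpha_1,\alpha_2\in\mathbb Z$, $E^\eta(u,U+\alpha):=E^\eta(u(\cdot+\alpha),U)$. Effective energy density. A deformation $\psi:\mathcal V\to\mathbb R^2$ is $k$-periodic ($k\in\mathbb N$, $k\ge1$) if $\psi(x+kv_1)=\psi(x+kv_2)=\psi(x)$ for all $x\in\mathcal V$; $\mathcal A^{\#}(kU)$ denotes the set of these. For $\lambda\in\mathbb R^{2\times2}$, $\lambda x+\psi$ denotes the deformation $x\mapsto\lambda x+\psi(x)$ on $\mathcal V$. Then $$\overline W^\eta(\lambda)=\inf_{k\in\mathbb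 N}\ \inf_{\psi\in\mathcal A^{\#}(kU)}\ \frac1{k^2|U|}\sum_{\alpha_1,\alpha_2=0}^{k-1}E^\eta(\lambda x+\psi,\,U+\alpha_1v_1+\alpha_2v_2).$$ *)

(* Defs.v *)
From HB Require Import structures.
From mathcomp Require Import all_boot all_order all_algebra.
From mathcomp Require Import classical_sets reals constructive_ereal ereal.

Set Implicit Arguments.
Unset Strict Implicit.
Unset Printing Implicit Defensive.

Import Order.TTheory GRing.Theory Num.Theory.
Local Open Scope classical_set_scope.
Local Open Scope ring_scope.

Section Geometry.
Variable R : realType.

Definition pt (x y : R) : 'cV[R]_2 := \col_(i < 2) (if i == 0 then x else y).

(* The library norm on matrices is the sup norm; the Euclidean one is needed. *)
Definition enorm (x : 'cV[R]_2) : R := Num.sqrt (\sum_(i < 2) x i 0 ^+ 2).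

Definition mx_of_cols (x y : 'cV[R]_2) : 'M[R]_2 := row_mx x y.

Lemma mul_mx_of_cols (L : 'M[R]_2) (x y : 'cV[R]_2) :
  L *m mx_of_cols x y = mx_of_cols (L *m x) (L *m y).
Proof. exact: (@mul_mx_row _ 2 2 1 1). Qed.

(* Shoelace formula; the vertices are listed in cyclic order. *)
Definition polygon_area (s : seq 'cV[R]_2) : R :=
  `|\sum_(i < size s) \det (mx_of_cols s`_i s`_(i.+1 %% size s))| / 2.

Definition triangle : Type := ('cV[R]_2 * 'cV[R]_2 * 'cV[R]_2)%type.

Definition triangle_area (T : triangle) : R :=
  let: (P, Q, N) := T in polygon_area [:: P; Q; N].

(* Gradient of the affine interpolant of u on a nondegenerate triangle;
   characterized by [grad_interpP]. *)
Definition grad_interp (u : 'cV[R]_2 -> 'cV[R]_2) (T : triangle) : 'M[R]_2 :=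
  let: (P, Q, N) := T in
  mx_of_cols (u Q - u P) (u N - u P) *m invmx (mx_of_cols (Q - P) (N - P)).

Lemma grad_interpP (u : 'cV[R]_2 -> 'cV[R]_2) (P Q N : 'cV[R]_2)
    (L : 'M[R]_2) :
  mx_of_cols (Q - P) (N - P) \in unitmx ->
  L = grad_interp u (P, Q, N) <->
  exists b : 'cV[R]_2,
    [/\ L *m P + b = u P, L *m Q + b = u Q & L *m N + b = u N].
Proof.
move=> unitT; split=> [->|[b [uP uQ uN]]].
  set G := grad_interp u _.
  have : G *m mx_of_cols (Q - P) (N - P) = mx_of_cols (u Q - u P) (u N - u P).
    by rewrite /G /grad_interp mulmxKV.
  rewrite mul_mx_of_cols => /(@eq_row_mx _ 2 1 1)[].
  rewrite !mulmxBr => eQ eS; exists (u P - G *m P).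
  by split; rewrite addrCA ?subrr ?addr0 ?eQ ?eS // addrC subrK.
rewrite /grad_interp -uP -uQ -uN; apply: (canRL (mulmxK unitT)).
rewrite mul_mx_of_cols !mulmxBr.
by congr mx_of_cols; rewrite opprD addrACA subrr addr0.
Qed.

End Geometry.

(* [springs] lists the pairs of endpoints (P, Q) with the coefficients c_PQ;
   [cell] lists the vertices of the unit cell U in cyclic order. *)
Record metamaterial (R : realType) := Metamaterial {
  lat1 : 'cV[R]_2;
  lat2 : 'cV[R]_2;
  basic_nodes : seq 'cV[R]_2;
  cell : seq 'cV[R]_2;
  springs : seq ('cV[R]_2 * 'cV[R]_2 * R);
  penalized : seq (triangle R)
}.

Section Energy.
Variable R : realType.
Variable M : metamaterial R.

Definition lattice_vec (a1 a2 : int) : 'cV[R]_2 := lat1 M *~ a1 + lat2 M *~ a2.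

Definition nodes : set 'cV[R]_2 :=
  [set x | exists (v : 'cV[R]_2) (a1 a2 : int),
     v \in basic_nodes M /\ x = v + lattice_vec a1 a2].

(* A deformation is represented by a function on the whole plane.  All spring
   endpoints and triangle vertices are nodes, so the energies below only
   involve its values on [nodes]; periodicity is only required there too. *)
Definition spring_energy (u : 'cV[R]_2 -> 'cV[R]_2) : R :=
  \sum_(s <- springs M)
    let: (P, Q, c) := s in c * (enorm (u P - u Q) - enorm (P - Q)) ^+ 2.

Definition penalty (eta t : R) : R := if t <= 0 then eta^-1 else 0.

Definition cell_energy (eta : R) (u : 'cV[R]_2 -> 'cV[R]_2) : R :=
  spring_energy u +
  \sum_(T <- penalized M) triangle_area T * penalty eta (\det (grad_interp u T)).

Definition shifted_cell_energy (eta : R) (u : 'cV[R]_2 -> 'cV[R]_2)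
    (a : 'cV[R]_2) : R :=
  cell_energy eta (fun x => u (x + a)).

Definition periodic (k : nat) : set ('cV[R]_2 -> 'cV[R]_2) :=
  [set psi | forall x, nodes x ->
     psi (x + lat1 M *+ k) = psi x /\ psi (x + lat2 M *+ k) = psi x].

Definition average_energy (eta : R) (lam : 'M[R]_2) (k : nat)
    (psi : 'cV[R]_2 -> 'cV[R]_2) : R :=
  (k%:R ^+ 2 * polygon_area (cell M))^-1 *
  \sum_(a1 < k) \sum_(a2 < k)
    shifted_cell_energy eta (fun x => lam *m x + psi x)
      (lattice_vec (a1 : nat)%:Z (a2 : nat)%:Z).

Definition effective_energy (eta : R) (lam : 'M[R]_2) : \bar R :=
  ereal_inf [set ereal_inf [set (average_energy eta lam k psi)%:E
                           | psi in periodic k]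
            | k in [set k : nat | (0 < k)%N]].

End Energy.

Definition kagome (R : realType) : metamaterial R :=
  let h := Num.sqrt 3 / 2 in
  let O := pt 0 0 in
  let A := pt (1 / 2) h in
  let B := pt (- (1 / 2)) h in
  let C := pt (- (1 / 2)) (- h) in
  let D := pt (1 / 2) (- h) in
  let E := pt (3 / 2) (- h) in
  let F := pt (3 / 2) h in
  {| lat1 := pt 2 0;
     lat2 := pt 1 (Num.sqrt 3);
     basic_nodes := [:: A; O; D];
     cell := [:: B; C; E; F];
     springs := [:: (A, O, 1); (B, O, 1); (C, O, 1);
                    (D, O, 1); (A, F, 1); (D, E, 1)];
     penalized := [:: (A, O, B); (C, O, D)] |}.

Definition rotating_squares (R : realType) : metamaterial R :=
  let A := pt (-1) 1 in
  let B := pt 0 1 in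
  let C := pt 1 1 in
  let D := pt (-1) 0 in
  let O := pt 0 0 in
  let E := pt 1 0 in
  let F := pt (-1) (-1) in
  let G := pt 0 (-1) in
  let H := pt 1 (-1) in
  {| lat1 := pt 2 0;
     lat2 := pt 0 2;
     basic_nodes := [:: O; A; B; D];
     cell := [:: A; C; H; F];
     springs := [:: (A, B, 1); (A, O, 2); (A, D, 1); (B, C, 1); (B, O, 1);
                    (D, O, 1); (E, O, 1); (D, F, 1); (O, G, 1); (O, H, 2)];
     penalized := [:: (A, O, B); (A, O, D); (E, O, H); (G, O, H)] |}.

Definition special_orthogonal (R : realType) : set 'M[R]_2 :=
  [set Q | Q *m Q^T = 1%:M /\ \det Q = 1].

Definition isotropic_compression (R : realType) (lam : 'M[R]_2) : Prop :=
  exists (c : R) (Q : 'M[R]_2),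
    [/\ 0 <= c, c <= 1, special_orthogonal Q & lam = c *: Q].

(* Main.v *)
Require Import Defs.
From HB Require Import structures.
From mathcomp Require Import all_boot all_order all_algebra.
From mathcomp Require Import classical_sets reals constructive_ereal ereal.
From mathcomp Require Import ring lra.

(** Write a linear map of the plane as [w |-> a w + b conj w] with complex [a]
    and [b]. It is a rotation when [b = 0] and [|a| = 1], and an isotropic
    compression when [b = 0] and [|a| <= 1]: the isotropic compressions are the
    convex hull of the rotations. The theorem is a quantitative form of this
    remark.

    Zero energy forces an isotropic compression. If a triangle of springs has
    energy [e], penalty included, then its gradient is within [O(sqrt e)] of a
    rotation ([local_rigidity]; the constant depends on [eta]). Each cell
    contains two such triangles, one the point reflection of the other, with
    vertices equal modulo the lattice, and the average of their gradients over
    all cells of a period is exactly [lam], because the periodic part of the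
    deformation cancels by periodicity. A deformation of average energy [eps]
    therefore shows that [lam] is within [O(sqrt eps)] of an average of
    rotations ([isotropic_of_average_defect],
    [isotropic_of_effective_energy0]). In the proof the gradient of a triangle
    is replaced by two edges [p] and [q] at a common vertex: [b] vanishes
    exactly when [q] is the image of [p] under the rotation that relates the
    reference edges.

    Isotropic compressions cost no energy. The compression of ratio [cos theta]
    is the average of the rotations of angles [theta] and [- theta]. Turning
    the triangles, or the squares, alternately by these angles is compatible
    with the hinges, periodic up to [lam] with the period of one cell,
    preserves every spring length and keeps all determinants equal to 1
    ([effective_energy_isotropic]). *)

Set Implicit Arguments.
Unset Strict Implicit.
Unset Printing Implicit Defensive.

Import Order.TTheory GRing.Theory Num.Theory.
Local Open Scope ring_scope.

(** * Vectors, rotations and the rigidity of a triangle *)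

Section Plane.
Variable R : realType.
Implicit Types f p q v w : 'cV[R]_2.

Lemma lift0_ord2 : lift 0 0 = 1 :> 'I_2.
Proof. exact/val_inj. Qed.

Lemma pt0E (x y : R) : pt x y 0 0 = x.
Proof. by rewrite /pt mxE. Qed.

Lemma pt1E (x y : R) : pt x y 1 0 = y.
Proof. by rewrite /pt mxE. Qed.

Lemma ptP v w : v 0 0 = w 0 0 -> v 1 0 = w 1 0 -> v = w.
Proof.
move=> e0 e1; apply/matrixP=> i j; rewrite (ord1 j).
by case: (unliftP 0 i) => [i' ->|->] //; rewrite (ord1 i') lift0_ord2.
Qed.

Lemma col_subE v w i : (v - w) i 0 = v i 0 - w i 0.
Proof. by rewrite !mxE. Qed.

Lemma col_addE v w i : (v + w) i 0 = v i 0 + w i 0.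
Proof. by rewrite !mxE. Qed.

Lemma enormE v : enorm v = Num.sqrt (v 0 0 ^+ 2 + v 1 0 ^+ 2).
Proof. by rewrite /enorm !big_ord_recl big_ord0 addr0 lift0_ord2. Qed.

Lemma enorm_ge0 v : 0 <= enorm v.
Proof. exact: sqrtr_ge0. Qed.

Lemma sqr_enorm v : enorm v ^+ 2 = v 0 0 ^+ 2 + v 1 0 ^+ 2.
Proof. by rewrite enormE sqr_sqrtr // addr_ge0 ?sqr_ge0. Qed.

Lemma enormN v : enorm (- v) = enorm v.
Proof. by rewrite !enormE !mxE !sqrrN. Qed.

Lemma enormB v w : enorm (v - w) = enorm (w - v).
Proof. by rewrite -enormN opprB. Qed.

Definition cross v w : R := v 0 0 * w 1 0 - v 1 0 * w 0 0.

Lemma mulmx_col0 (L : 'M[R]_2) v : (L *m v) 0 0 = L 0 0 * v 0 0 + L 0 1 * v 1 0.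
Proof. by rewrite mxE !big_ord_recl big_ord0 addr0 lift0_ord2. Qed.

Lemma mulmx_col1 (L : 'M[R]_2) v : (L *m v) 1 0 = L 1 0 * v 0 0 + L 1 1 * v 1 0.
Proof. by rewrite mxE !big_ord_recl big_ord0 addr0 lift0_ord2. Qed.

Lemma mx_of_colsE v w i (j : 'I_2) :
  mx_of_cols v w i j = if j == 0 then v i 0 else w i 0.
Proof.
rewrite /mx_of_cols mxE; case: splitP => k; rewrite (ord1 k) => jk.
  by rewrite (_ : j == 0) //; apply/eqP/val_inj.
by rewrite (_ : j == 0 = false) //; apply/negP=> /eqP j0; rewrite j0 in jk.
Qed.

Lemma det_mx2 (A : 'M[R]_2) : \det A = A 0 0 * A 1 1 - A 0 1 * A 1 0.
Proof.
rewrite (expand_det_row _ 0) !big_ord_recl big_ord0 /cofactor !det_mx11 !mxE.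
rewrite lift0_ord2 (_ : lift 1 0 = 0) /=; last exact/val_inj.
by rewrite addr0 expr0 expr1 mul1r mulN1r mulrN.
Qed.

Lemma det_mx_of_cols v w : \det (mx_of_cols v w) = cross v w.
Proof. by rewrite det_mx2 !mx_of_colsE /= /cross [w 0 0 * _]mulrC. Qed.

Lemma det_grad_interp (u : 'cV[R]_2 -> 'cV[R]_2) P Q N :
  \det (grad_interp u (P, Q, N)) =
  cross (u Q - u P) (u N - u P) / cross (Q - P) (N - P).
Proof. by rewrite /grad_interp det_mulmx det_inv !det_mx_of_cols. Qed.

(** Multiplication by the complex number [a + i b]. *)
Definition similarity (a b : R) : 'M[R]_2 := mx_of_cols (pt a b) (pt (- b) a).

Lemma similarity_col0 a b v :
  (similarity a b *m v) 0 0 = a * v 0 0 - b * v 1 0.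
Proof. by rewrite mulmx_col0 !mx_of_colsE /= !pt0E mulNr. Qed.

Lemma similarity_col1 a b v :
  (similarity a b *m v) 1 0 = b * v 0 0 + a * v 1 0.
Proof. by rewrite mulmx_col1 !mx_of_colsE /= !pt1E. Qed.

(** The energy of one triangle with sides [1], [f], [f - 1] deformed to [p],
    [q], [q - p]: squared defects of the three lengths (hence [f] is meant to
    be a unit vector), and a charge [m] when the orientation is lost. *)
Definition triangle_defect (m : R) f p q : R :=
  (enorm p - 1) ^+ 2 + (enorm q - 1) ^+ 2
  + (enorm (q - p) - enorm (f - pt 1 0)) ^+ 2
  + (if cross p q <= 0 then m else 0).

(** [P] and [Q] are the lengths of two edges, [G] and [D] their dot and cross
    products, [g] and [d] the values of [G] and [D] on the reference triangle.
    The points [(G, D)] and [P * Q * (g, d)] lie on the same circle, so that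
    a small [G - g * (P * Q)] leaves two possibilities for [D]; the sign of [D]
    selects one.  The bracket on the left is half the squared distance of the
    two points, divided by the radius [P * Q]. *)
Lemma dot_defect_controls_angle (g d P Q G D : R) :
  0 < d -> g ^+ 2 + d ^+ 2 = 1 ->
  3 / 4 <= P -> 3 / 4 <= Q -> 0 < D -> G ^+ 2 + D ^+ 2 = (P * Q) ^+ 2 ->
  d ^+ 2 * (P * Q - g * G - d * D) <= 5 * (G - g * (P * Q)) ^+ 2.
Proof.
move=> d0 gd1 hP hQ D0 GD.
have : 1 / 2 < P * Q by nra.
move: (P * Q) GD => m GD m12 {P Q hP hQ}.
(* The circle equation, factored; [D + d * m] is at least [d * m] as [D > 0]. *)
have eqD : (D - d * m) * (D + d * m) = (g * m - G) * (g * m + G) by nra.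
have hx : d * `|D - d * m| <= 2 * `|G - g * m|.
  have m0 : 0 < m by lra.
  rewrite -(ler_pM2r m0).
  have -> : 2 * `|G - g * m| * m = `|g * m - G| * (2 * m).
    by rewrite distrC; ring.
  apply: (@le_trans _ _ (`|D - d * m| * (D + d * m))).
    rewrite mulrAC mulrC ler_wpM2l ?normr_ge0 //; lra.
  rewrite -[D + d * m]ger0_norm; last by nra.
  rewrite -normrM eqD normrM ler_wpM2l ?normr_ge0 // ler_norml.
  have hg : -1 <= g /\ g <= 1 by have := sqr_ge0 d; split; nra.
  have hG : - m <= G /\ G <= m by have := sqr_ge0 D; split; nra.
  by apply/andP; case: hg; case: hG => *; split; nra.
have hx2 : d ^+ 2 * (D - d * m) ^+ 2 <= 4 * (G - g * m) ^+ 2.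
  rewrite -(real_normK (num_real (D - d * m))) -(real_normK (num_real (G - _))).
  have -> : 4 = 2 ^+ 2 :> R by rewrite -natrX.
  by rewrite -!exprMn ler_sqr // nnegrE mulr_ge0 ?normr_ge0 // ltW.
have dd : d ^+ 2 <= 1 by nra.
have eq2 : 2 * m * (m - g * G - d * D) = (G - g * m) ^+ 2 + (D - d * m) ^+ 2.
  rewrite (_ : (G - _) ^+ 2 + _ =
    G ^+ 2 + D ^+ 2 + m ^+ 2 * (g ^+ 2 + d ^+ 2) - 2 * m * (g * G + d * D)).
    by rewrite GD gd1; ring.
  by ring.
have pos : 0 <= m - g * G - d * D.
  have : 0 <= 2 * m * (m - g * G - d * D) by rewrite eq2 addr_ge0 ?sqr_ge0.
  rewrite pmulr_rge0 //; lra.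
apply: (@le_trans _ _ (d ^+ 2 * (2 * m * (m - g * G - d * D)))).
  rewrite ler_wpM2l ?sqr_ge0 // ler_peMl //; lra.
rewrite eq2 mulrDr.
have := sqr_ge0 (G - g * m); nra.
Qed.

(** Cauchy-Schwarz, by Lagrange's identity. *)
Lemma sqr_lin3_le (a b c A B C M : R) :
  A ^+ 2 <= M -> B ^+ 2 <= M -> C ^+ 2 <= M ->
  (a * A + b * B - c * C) ^+ 2 <= 3 * M * (a ^+ 2 + b ^+ 2 + c ^+ 2).
Proof.
move=> hA hB hC.
apply: (@le_trans _ _
  ((A ^+ 2 + B ^+ 2 + C ^+ 2) * (a ^+ 2 + b ^+ 2 + c ^+ 2))).
  rewrite -subr_ge0 (_ : _ - _ = (a * B - b * A) ^+ 2
    + (a * C + c * A) ^+ 2 + (b * C + c * B) ^+ 2); last by ring.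
  by rewrite !addr_ge0 ?sqr_ge0.
by rewrite ler_wpM2r ?addr_ge0 ?sqr_ge0 //; lra.
Qed.

(** By the law of cosines the dot product is a polynomial in the three side
    lengths, and this polynomial factors through the three length defects; the
    cofactors are bounded once the defects are small. *)
Lemma side_defects_control_dot (g d P Q S s : R) : g ^+ 2 + d ^+ 2 = 1 ->
    s ^+ 2 = 2 - 2 * g -> 0 <= s ->
    (P - 1) ^+ 2 + (Q - 1) ^+ 2 + (S - s) ^+ 2 <= 1 / 16 ->
  [/\ 3 / 4 <= P, 3 / 4 <= Q &
   ((P ^+ 2 + Q ^+ 2 - S ^+ 2) / 2 - g * (P * Q)) ^+ 2 <=
   100 * ((P - 1) ^+ 2 + (Q - 1) ^+ 2 + (S - s) ^+ 2)].
Proof.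
move=> gd1 sg s0 hE.
have small (x y z : R) : x ^+ 2 + y ^+ 2 + z ^+ 2 <= 1 / 16 ->
    - (1 / 4) <= x /\ x <= 1 / 4.
  by have := sqr_ge0 y; have := sqr_ge0 z; move=> *; split; nra.
have [P1 P2] := small _ _ _ hE.
have [Q1 Q2] : - (1 / 4) <= Q - 1 /\ Q - 1 <= 1 / 4.
  by apply: small; rewrite [X in X + _]addrC; exact: hE.
have [S1 S2] : - (1 / 4) <= S - s /\ S - s <= 1 / 4.
  by apply: small; rewrite -addrA [X in X <= _]addrC; exact: hE.
split; [lra | lra |].
have [g1 g2] : -1 <= g /\ g <= 1 by clear -gd1; have := sqr_ge0 d; split; nra.
have s2 : s <= 2 by clear -sg g1 s0; nra.
rewrite (_ : _ - _ = ((P - 1) * (P + 1 - 2 * g * Q) + (Q - 1) * (Q + 1 - 2 * g)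
    - (S - s) * (S + s)) / 2); last first.
  have -> : (S - s) * (S + s) = S ^+ 2 - (2 - 2 * g) by rewrite -sg; ring.
  by field.
have sq5 (x : R) : -5 <= x -> x <= 5 -> x ^+ 2 <= 25 by clear; nra.
rewrite exprMn.
have : ((P - 1) * (P + 1 - 2 * g * Q) + (Q - 1) * (Q + 1 - 2 * g)
    - (S - s) * (S + s)) ^+ 2 <=
    3 * 25 * ((P - 1) ^+ 2 + (Q - 1) ^+ 2 + (S - s) ^+ 2).
  apply: sqr_lin3_le; apply: sq5; clear -P1 P2 Q1 Q2 S1 S2 g1 g2 s0 s2; nra.
have : 0 <= (P - 1) ^+ 2 + (Q - 1) ^+ 2 + (S - s) ^+ 2.
  by rewrite !addr_ge0 ?sqr_ge0.
move: (_ ^+ 2) ((P - 1) ^+ 2 + _ + _) => x y; clear; lra.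
Qed.

(** Quantitative rigidity of a triangle: an edge pair of small energy is close
    to being rotated rigidly, since [q] is then almost the image of [p] under
    the reference rotation. When the energy is below a threshold the
    orientation is the right one and [side_defects_control_dot] and
    [dot_defect_controls_angle] apply. Above the threshold the left-hand side
    grows at most like the energy, and the bounded remainder is absorbed by a
    constant that depends on the threshold. *)
Lemma local_rigidity (g d m : R) : 0 < d -> g ^+ 2 + d ^+ 2 = 1 -> 0 < m ->
  exists2 K : R, 0 < K & forall p q,
    enorm (q - similarity g d *m p) ^+ 2 <= K * triangle_defect m (pt g d) p q.
Proof.
move=> d0 gd1 m0.
have g1 : g < 1 by nra.
have gm1 : -1 < g by nra.
set s0 := enorm (pt g d - pt 1 0).
have s0E : s0 ^+ 2 = 2 - 2 * g.
  by rewrite sqr_enorm !mxE /=; nra.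
have s00 : 0 <= s0 by exact: enorm_ge0.
have s02 : s0 <= 2 by nra.
(* Below [mu] the triangle keeps its orientation and each side length is
   within 1/4 of its reference value. *)
pose mu := Num.min m (1 / 16).
have mu0 : 0 < mu by rewrite lt_min m0; lra.
pose K := Num.max (4 + 8 / mu) (2 + 1000 / d ^+ 2).
have d20 : 0 < d ^+ 2 by rewrite exprn_gt0.
exists K.
  by rewrite lt_max addr_gt0 // divr_gt0.
move=> p q; set E := triangle_defect _ _ _ _.
pose P := enorm p; pose Q := enorm q; pose S := enorm (q - p).
pose pen := if cross p q <= 0 then m else 0.
have pen0 : 0 <= pen by rewrite /pen; case: ifP => // _; exact: ltW.
have EE : E = (P - 1) ^+ 2 + (Q - 1) ^+ 2 + (S - s0) ^+ 2 + pen by [].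
have P2 : P ^+ 2 = p 0 0 ^+ 2 + p 1 0 ^+ 2 by exact: sqr_enorm.
have Q2 : Q ^+ 2 = q 0 0 ^+ 2 + q 1 0 ^+ 2 by exact: sqr_enorm.
have S2 : S ^+ 2 = (q 0 0 - p 0 0) ^+ 2 + (q 1 0 - p 1 0) ^+ 2.
  by rewrite /S sqr_enorm !mxE.
have P0 : 0 <= P by exact: enorm_ge0.
have Q0 : 0 <= Q by exact: enorm_ge0.
have S0 : 0 <= S by exact: enorm_ge0.
pose G := p 0 0 * q 0 0 + p 1 0 * q 1 0.
pose D := cross p q.
have LE : enorm (q - similarity g d *m p) ^+ 2 =
    (P - Q) ^+ 2 + 2 * (P * Q - g * G - d * D).
  rewrite sqr_enorm !col_subE similarity_col0 similarity_col1.
  rewrite (_ : _ + _ = (q 0 0 ^+ 2 + q 1 0 ^+ 2)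
     + (g ^+ 2 + d ^+ 2) * (p 0 0 ^+ 2 + p 1 0 ^+ 2) - 2 * (g * G + d * D)).
    by rewrite gd1 -P2 -Q2 /G /D /cross; ring.
  by rewrite /G /D /cross; ring.
have E0 : 0 <= E.
  by rewrite EE !addr_ge0 ?sqr_ge0.
have [Emu|Emu] := lerP mu E.
  apply: (@le_trans _ _ ((4 + 8 / mu) * E)); last first.
    by rewrite ler_wpM2r // le_max lexx.
  have : 8 <= 8 / mu * E.
    by rewrite mulrAC ler_pdivlMr // ler_pM2l.
  suff : enorm (q - similarity g d *m p) ^+ 2 <= 4 * E + 8 by lra.
  (* The parallelogram identity. *)
  have LE' : enorm (q + similarity g d *m p) ^+ 2 =
      2 * (P ^+ 2 + Q ^+ 2) - enorm (q - similarity g d *m p) ^+ 2.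
    rewrite !sqr_enorm !col_subE !col_addE similarity_col0 similarity_col1.
    apply/subr0_eq; rewrite (_ : _ - _ =
      2 * (g ^+ 2 + d ^+ 2 - 1) * (p 0 0 ^+ 2 + p 1 0 ^+ 2)); last by ring.
    by rewrite gd1 subrr mulr0 mul0r.
  have := sqr_ge0 (enorm (q + similarity g d *m p)); rewrite LE'.
  have := sqr_ge0 (P - 2); have := sqr_ge0 (Q - 2); have := sqr_ge0 (S - s0).
  rewrite EE; lra.
apply: (@le_trans _ _ ((2 + 1000 / d ^+ 2) * E)); last first.
  by rewrite ler_wpM2r // le_max lexx orbT.
have Em : E < m by rewrite (lt_le_trans Emu) // ge_min lexx.
have E16 : E < 1 / 16 by rewrite (lt_le_trans Emu) // ge_min lexx orbT.
have D0 : 0 < D.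
  rewrite ltNge; apply/negP=> D0; move: EE; rewrite /pen D0.
  have := sqr_ge0 (P - 1); have := sqr_ge0 (Q - 1); have := sqr_ge0 (S - s0).
  lra.
have pen00 : pen = 0 by rewrite /pen leNgt D0.
rewrite pen00 addr0 in EE.
have [P34 Q34 dG2] : [/\ 3 / 4 <= P, 3 / 4 <= Q
    & ((P ^+ 2 + Q ^+ 2 - S ^+ 2) / 2 - g * (P * Q)) ^+ 2 <= 100 * E].
  by rewrite EE; apply: (side_defects_control_dot gd1) => //; rewrite -EE ltW.
have GE : (P ^+ 2 + Q ^+ 2 - S ^+ 2) / 2 = G by rewrite P2 Q2 S2 /G; field.
rewrite {}GE in dG2.
have GD : G ^+ 2 + D ^+ 2 = (P * Q) ^+ 2.
  by rewrite exprMn P2 Q2 /G /D /cross; ring.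
have near := dot_defect_controls_angle d0 gd1 P34 Q34 D0 GD.
rewrite LE [leRHS]mulrDl.
apply: lerD.
  have := sqr_ge0 (P - 1 + (Q - 1)); have := sqr_ge0 (S - s0); rewrite EE; lra.
rewrite mulrAC ler_pdivlMr //.
rewrite (_ : _ * d ^+ 2 = 2 * (d ^+ 2 * (P * Q - g * G - d * D))); last by ring.
lra.
Qed.

(** * Similarities, and averages of nearly rigid triangles *)

Lemma le_add_sqr_div (x t : R) : 0 < t -> `|x| <= t + x ^+ 2 / t.
Proof.
move=> t0; rewrite -lerBlDl ler_pdivlMr // -(real_normK (num_real x)).
have := sqr_ge0 (`|x| - t); have := sqr_ge0 `|x|; have := sqr_ge0 t; lra.
Qed.

Lemma dot_le_enorm (v w : 'cV[R]_2) :
  v 0 0 * w 0 0 + v 1 0 * w 1 0 <= enorm v * enorm w.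
Proof.
apply: le_trans (ler_norm _) _.
rewrite -ler_sqr ?nnegrE ?normr_ge0 ?mulr_ge0 ?enorm_ge0 //.
rewrite real_normK ?num_real // exprMn !sqr_enorm -subr_ge0.
rewrite (_ : _ - _ = (v 0 0 * w 1 0 - v 1 0 * w 0 0) ^+ 2) ?sqr_ge0 //.
by ring.
Qed.

Lemma mx2P (A B : 'M[R]_2) : A 0 0 = B 0 0 -> A 0 1 = B 0 1 ->
  A 1 0 = B 1 0 -> A 1 1 = B 1 1 -> A = B.
Proof.
move=> e00 e01 e10 e11; apply/matrixP=> i j.
case: (unliftP 0 i) => [i' ->|->]; rewrite ?(ord1 i') ?lift0_ord2;
by case: (unliftP 0 j) => [j' ->|->]; rewrite ?(ord1 j') ?lift0_ord2.
Qed.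

Lemma similarityE (a b : R) :
  (similarity a b 0 0 = a) * (similarity a b 0 1 = - b) *
  (similarity a b 1 0 = b) * (similarity a b 1 1 = a).
Proof. by rewrite !mx_of_colsE /= !pt0E !pt1E. Qed.

Lemma scale_similarity (c a b : R) :
  c *: similarity a b = similarity (c * a) (c * b).
Proof. by apply: mx2P; rewrite mxE !similarityE // mulrN. Qed.

Lemma similarity0 : similarity 0 0 = 0 :> 'M[R]_2.
Proof. by apply: mx2P; rewrite similarityE mxE ?oppr0. Qed.

Lemma mulmx_trE (Q : 'M[R]_2) i j :
  (Q *m Q^T) i j = Q i 0 * Q j 0 + Q i 1 * Q j 1.
Proof.
by rewrite mxE !big_ord_recl big_ord0 lift0_ord2 addr0 ![_^T _ _]mxE.
Qed.

Lemma similarity_SO (a b : R) :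
  special_orthogonal (similarity a b) <-> a ^+ 2 + b ^+ 2 = 1.
Proof.
rewrite /special_orthogonal /= det_mx2 !similarityE mulNr opprK -!expr2.
split=> [[]//|ab]; split=> //; apply: mx2P;
  rewrite mulmx_trE !similarityE [RHS]mxE /= -ab; ring.
Qed.

Lemma special_orthogonalP (Q : 'M[R]_2) : special_orthogonal Q ->
  exists a b, a ^+ 2 + b ^+ 2 = 1 /\ Q = similarity a b.
Proof.
move=> [QQ]; rewrite det_mx2 => dQ; exists (Q 0 0), (Q 1 0).
have := mulmx_trE Q 0 0; have := mulmx_trE Q 0 1; have := mulmx_trE Q 1 1.
rewrite QQ !mxE /= => q11 q01 q00.
(* [Q^T] is the inverse of [Q], hence its adjugate. *)
have e1 : Q 1 1 = Q 0 0.
  rewrite -[LHS]mulr1 -[in LHS]dQ.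
  rewrite (_ : _ * _ = Q 0 0 * (Q 1 0 * Q 1 0 + Q 1 1 * Q 1 1) -
    Q 1 0 * (Q 0 0 * Q 1 0 + Q 0 1 * Q 1 1)); last by ring.
  by rewrite -q11 -q01; ring.
have e2 : Q 1 0 = - Q 0 1.
  rewrite -[LHS]mulr1 -[in LHS]dQ.
  rewrite (_ : _ * _ = Q 1 1 * (Q 0 0 * Q 1 0 + Q 0 1 * Q 1 1) -
    Q 0 1 * (Q 1 0 * Q 1 0 + Q 1 1 * Q 1 1)); last by ring.
  by rewrite -q11 -q01; ring.
split; first by apply: (etrans _ (esym q00)); rewrite e2; ring.
by apply: mx2P; rewrite similarityE // e2 opprK.
Qed.

Lemma isotropic_compressionP (lam : 'M[R]_2) :
  lam 0 1 = - lam 1 0 -> lam 1 1 = lam 0 0 ->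
  lam 0 0 ^+ 2 + lam 1 0 ^+ 2 <= 1 ->
  isotropic_compression lam.
Proof.
move=> l01 l11 le1; set a := lam 0 0 in l11 le1; set b := lam 1 0 in l01 le1.
have lamE : lam = similarity a b.
  by apply: mx2P; rewrite similarityE.
pose c := Num.sqrt (a ^+ 2 + b ^+ 2).
have ab0 : 0 <= a ^+ 2 + b ^+ 2 by rewrite addr_ge0 ?sqr_ge0.
have c2 : c ^+ 2 = a ^+ 2 + b ^+ 2 by rewrite sqr_sqrtr.
have c0 : 0 <= c by exact: sqrtr_ge0.
have [cz|cnz] := eqVneq c 0.
  exists 0, (similarity 1 0); split; rewrite ?ler01 //.
    by apply/similarity_SO; rewrite expr0n addr0 expr1n.
  move: c2; rewrite cz expr0n => /esym/eqP; rewrite paddr_eq0 ?sqr_ge0 //.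
  rewrite !sqrf_eq0 => /andP[/eqP az /eqP bz].
  by rewrite scale0r lamE az bz similarity0.
exists c, (similarity (a / c) (b / c)); split => //.
- by rewrite -ler_sqr ?nnegrE // c2 expr1n.
- by apply/similarity_SO; rewrite !expr_div_n -mulrDl -c2 divff ?sqrf_eq0.
- by rewrite scale_similarity ![c * _]mulrC !divfK.
Qed.

Lemma le0_of_le_mul (x K : R) : (forall t, 0 < t -> x <= K * t) -> x <= 0.
Proof.
move=> h; rewrite leNgt; apply/negP=> x0.
have M0 : 0 < `|K| + 1 by rewrite ltr_wpDl.
have := h (x / (`|K| + 1)); rewrite divr_gt0 // => /(_ isT).
rewrite mulrA ler_pdivlMr // [K * x]mulrC ler_pM2l //.
have := ler_norm K; lra.
Qed.

(** The core of the necessity.  Rigidity and averaging show that [lam] commutes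
    with the reference rotation on [pt 1 0], so that [lam] is a similarity; its
    factor is at most 1 because the image of [pt 1 0] is an average of edges
    whose lengths are nearly 1.  The defects are quadratic in the deviations,
    and [le_add_sqr_div] turns this into a bound of the average deviation. *)
Lemma isotropic_of_average_defect (lam : 'M[R]_2) (g d m : R) :
    0 < d -> g ^+ 2 + d ^+ 2 = 1 -> 0 < m ->
    (forall eps : R, 0 < eps -> exists (J : finType) (p q : J -> 'cV[R]_2),
      [/\ (0 < #|J|)%N, \sum_j p j = (lam *m pt 1 0) *+ #|J|,
          \sum_j q j = (lam *m pt g d) *+ #|J|
        & \sum_j triangle_defect m (pt g d) (p j) (q j) <= eps * #|J|%:R]) ->
  isotropic_compression lam.
Proof.
move=> d0 gd1 m0 small.
have [K K0 rigid] := local_rigidity d0 gd1 m0.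
have defect_ge0 p q : 0 <= triangle_defect m (pt g d) p q.
  by rewrite !addr_ge0 ?sqr_ge0 //; case: ifP => // _; exact: ltW.
pose w := lam *m pt g d - similarity g d *m (lam *m pt 1 0).
have w0 i : w i 0 = 0.
  apply/eqP; rewrite -normr_le0; apply: (@le0_of_le_mul _ (1 + K)) => t t0.
  have [J [p [q [J0 sp sq sE]]]] := small (t ^+ 2) (exprn_gt0 _ t0).
  rewrite -(ler_pM2r (_ : 0 < #|J|%:R)) ?ltr0n //.
  have -> : `|w i 0| * #|J|%:R = `|\sum_j (q j - similarity g d *m p j) i 0|.
    rewrite -{1}[#|J|%:R]normr_nat -normrM mulr_natr -mulmxnE.
    rewrite -summxE big_split /= sumrN -mulmx_sumr sp sq.
    by rewrite raddfMn -mulrnBl.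
  apply: le_trans (ler_norm_sum _ _ _) _.
  apply: (@le_trans _ _
    (\sum_j (t + K * triangle_defect m (pt g d) (p j) (q j) / t))).
    apply: ler_sum => j _; apply: le_trans (le_add_sqr_div _ t0) _.
    rewrite lerD2l ler_pM2r ?invr_gt0 //; apply: le_trans (rigid _ _).
    rewrite sqr_enorm; set v := q j - _.
    by case: (unliftP 0 i) => [i' ->|->]; rewrite ?(ord1 i') ?lift0_ord2;
       [rewrite lerDr sqr_ge0 | rewrite lerDl sqr_ge0].
  rewrite big_split /= sumr_const -mulr_suml -mulr_sumr.
  rewrite -[t *+ _]mulr_natr mulrDl mul1r mulrDl lerD2l.
  by rewrite ler_pdivrMr // -!mulrA ler_pM2l // mulrCA -expr2 mulrC.
have n1 : enorm (lam *m pt 1 0) <= 1.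
  set n := lam *m pt 1 0 in w w0 small *.
  have [->|/eqP] := eqVneq (enorm n) 0; first exact: ler01.
  have := enorm_ge0 n; rewrite le_eqVlt eq_sym => /predU1P[-> //|N0] _.
  rewrite -subr_le0; apply: (@le0_of_le_mul _ 2) => t t0.
  have [J [p [q [J0 sp sq sE]]]] := small (t ^+ 2) (exprn_gt0 _ t0).
  have J0R : (0 : R) < #|J|%:R by rewrite ltr0n.
  rewrite lerBlDl -(ler_pM2r N0) -expr2 -(ler_pM2r J0R).
  have -> : enorm n ^+ 2 * #|J|%:R = \sum_j (n 0 0 * p j 0 0 + n 1 0 * p j 1 0).
    rewrite big_split /= -!mulr_sumr -!summxE sp !mulmxnE sqr_enorm.
    by rewrite -[n 0 0 *+ _]mulr_natr -[n 1 0 *+ _]mulr_natr; ring.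
  apply: (@le_trans _ _ (\sum_j (enorm n *
      (1 + (t + triangle_defect m (pt g d) (p j) (q j) / t))))).
    apply: ler_sum => j _; apply: le_trans (dot_le_enorm _ _) _.
    rewrite ler_pM2l // -lerBlDl.
    apply: le_trans (ler_norm _) _; apply: le_trans (le_add_sqr_div _ t0) _.
    rewrite lerD2l ler_pM2r ?invr_gt0 // /triangle_defect -!addrA lerDl.
    by rewrite !addr_ge0 ?sqr_ge0 //; case: ifP => // _; exact: ltW.
  rewrite -mulr_sumr.
  rewrite [leRHS]mulrAC [leRHS]mulrC ler_pM2l // !big_split /= !sumr_const.
  rewrite -mulr_suml -[t *+ _]mulr_natr.
  have : (\sum_j triangle_defect m (pt g d) (p j) (q j)) / t <= t * #|J|%:R.
    by rewrite ler_pdivrMr // mulrAC -expr2.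
  lra.
have := w0 0; have := w0 1.
have := sqr_enorm (lam *m pt 1 0).
rewrite /w !col_subE similarity_col0 similarity_col1 !mulmx_col0 !mulmx_col1.
rewrite !pt0E !pt1E !mulr1 !mulr0 !addr0 => eN e1 e0.
have n0 := enorm_ge0 (lam *m pt 1 0).
have l01 : lam 0 1 = - lam 1 0.
  by apply: (mulfI (lt0r_neq0 d0)); apply/subr0_eq; rewrite -e0; ring.
have l11 : lam 1 1 = lam 0 0.
  by apply: (mulfI (lt0r_neq0 d0)); apply/subr0_eq; rewrite -e1; ring.
apply: isotropic_compressionP => //; rewrite -eN; clear -n0 n1; nra.
Qed.

End Plane.

(** * Sums over the cells of a periodic deformation *)

Section PeriodicSums.
Variables (V : zmodType) (k : nat).

Lemma sum_shift1 (h : int -> V) (b : int) :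
  (forall a, h (a + k%:Z) = h a) ->
  \sum_(a < k) h ((a : nat)%:Z + (b + 1)) = \sum_(a < k) h ((a : nat)%:Z + b).
Proof.
move=> hk; apply: (addrI (h b)).
have := erefl (\sum_(a < k.+1) h ((a : nat)%:Z + b)).
rewrite {1}big_ord_recl big_ord_recr /= add0r [k%:Z + b]addrC hk.
move=> E; rewrite [RHS]addrC -E; congr (_ + _); apply: eq_bigr => a _.
by congr h; rewrite /bump /= PoszD; ring.
Qed.

Lemma sum_shift (h : int -> V) (b : int) :
  (forall a, h (a + k%:Z) = h a) ->
  \sum_(a < k) h ((a : nat)%:Z + b) = \sum_(a < k) h (a : nat)%:Z.
Proof.
move=> hk; elim/int_ind: b => [|n IH|n IH].
- by apply: eq_bigr => a _; rewrite addr0.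
- by rewrite -addn1 PoszD sum_shift1 ?IH.
- rewrite -IH -(sum_shift1 (- n.+1%:Z)) //; apply: eq_bigr => a _.
  by congr h; rewrite -addn1 PoszD; ring.
Qed.

Lemma sum_shift2 (h : int -> int -> V) (b1 b2 : int) :
  (forall a1 a2, h (a1 + k%:Z) a2 = h a1 a2) ->
  (forall a1 a2, h a1 (a2 + k%:Z) = h a1 a2) ->
  \sum_(a1 < k) \sum_(a2 < k) h ((a1 : nat)%:Z + b1) ((a2 : nat)%:Z + b2) =
  \sum_(a1 < k) \sum_(a2 < k) h (a1 : nat)%:Z (a2 : nat)%:Z.
Proof.
move=> h1 h2.
rewrite (sum_shift (h := fun a => \sum_(a2 < k) h a ((a2 : nat)%:Z + b2))).
  by apply: eq_bigr => a1 _; apply: sum_shift.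
by move=> a; apply: eq_bigr => a2 _.
Qed.

End PeriodicSums.

Section Lattice.
Variables (R : realType) (M : metamaterial R).

Lemma lattice_vecD a1 a2 b1 b2 :
  lattice_vec M (a1 + b1) (a2 + b2) = lattice_vec M a1 a2 + lattice_vec M b1 b2.
Proof. by rewrite /lattice_vec !mulrzDr addrACA. Qed.

Lemma nodes_shift P b1 b2 : nodes M P -> nodes M (P + lattice_vec M b1 b2).
Proof.
move=> [v [a1 [a2 [vM ->]]]]; exists v, (a1 + b1), (a2 + b2).
by split; rewrite ?lattice_vecD ?addrA.
Qed.

Section Cells.
Variables (lam : 'M[R]_2) (k : nat) (psi : 'cV[R]_2 -> 'cV[R]_2).
Hypothesis psik : periodic M k psi.

Definition deformed_edge P Q (a1 a2 : int) : 'cV[R]_2 :=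
  (lam *m (P + lattice_vec M a1 a2) + psi (P + lattice_vec M a1 a2)) -
  (lam *m (Q + lattice_vec M a1 a2) + psi (Q + lattice_vec M a1 a2)).

Lemma deformed_edgeE P Q a1 a2 : deformed_edge P Q a1 a2 = lam *m (P - Q)
  + (psi (P + lattice_vec M a1 a2) - psi (Q + lattice_vec M a1 a2)).
Proof.
rewrite /deformed_edge opprD addrACA -mulmxBr; congr (_ *m _ + _).
by rewrite opprD addrACA subrr addr0.
Qed.

Lemma psi_shiftl P a1 a2 : nodes M P ->
  psi (P + lattice_vec M (a1 + k%:Z) a2) = psi (P + lattice_vec M a1 a2).
Proof.
move=> nP; have [<- _] := psik (nodes_shift a1 a2 nP).
rewrite -[in LHS](addr0 a2) lattice_vecD addrA.
by rewrite {2}/lattice_vec mulr0z addr0 -pmulrn.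
Qed.

Lemma psi_shiftr P a1 a2 : nodes M P ->
  psi (P + lattice_vec M a1 (a2 + k%:Z)) = psi (P + lattice_vec M a1 a2).
Proof.
move=> nP; have [_ <-] := psik (nodes_shift a1 a2 nP).
rewrite -[in LHS](addr0 a1) lattice_vecD addrA.
by rewrite {2}/lattice_vec mulr0z add0r -pmulrn.
Qed.

Lemma sum_deformed_edge_shift (F : 'cV[R]_2 -> R) P Q P' Q' b1 b2 :
  nodes M P -> nodes M Q ->
  P' = P + lattice_vec M b1 b2 -> Q' = Q + lattice_vec M b1 b2 ->
  \sum_(a1 < k) \sum_(a2 < k)
    F (deformed_edge P' Q' (a1 : nat)%:Z (a2 : nat)%:Z) =
  \sum_(a1 < k) \sum_(a2 < k)
    F (deformed_edge P Q (a1 : nat)%:Z (a2 : nat)%:Z).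
Proof.
move=> nP nQ -> ->.
rewrite -(sum_shift2 (h := fun a1 a2 => F (deformed_edge P Q a1 a2)) b1 b2).
- apply: eq_bigr => a1 _; apply: eq_bigr => a2 _; congr F.
  by rewrite /deformed_edge ![_%:Z + _]addrC lattice_vecD !addrA.
- by move=> a1 a2; rewrite !deformed_edgeE !psi_shiftl.
- by move=> a1 a2; rewrite !deformed_edgeE !psi_shiftr.
Qed.

Definition lattice_sum P :=
  \sum_(a1 < k) \sum_(a2 < k)
    psi (P + lattice_vec M (a1 : nat)%:Z (a2 : nat)%:Z).

Lemma lattice_sum_shift P P' b1 b2 :
  nodes M P -> P' = P + lattice_vec M b1 b2 -> lattice_sum P' = lattice_sum P.
Proof.
move=> nP ->.
rewrite /lattice_sum.
rewrite -(sum_shift2 (h := fun a1 a2 => psi (P + lattice_vec M a1 a2)) b1 b2).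
- apply: eq_bigr => a1 _; apply: eq_bigr => a2 _; congr psi.
  by rewrite ![_%:Z + _]addrC lattice_vecD !addrA.
- by move=> a1 a2; rewrite psi_shiftl.
- by move=> a1 a2; rewrite psi_shiftr.
Qed.

Lemma sum_deformed_edge P Q :
  \sum_(a1 < k) \sum_(a2 < k) deformed_edge P Q (a1 : nat)%:Z (a2 : nat)%:Z =
  (lam *m (P - Q)) *+ (k * k) + (lattice_sum P - lattice_sum Q).
Proof.
rewrite /lattice_sum -sumrB.
under eq_bigr => a1 _ do under eq_bigr => a2 _ do rewrite deformed_edgeE.
under eq_bigr => a1 _ do rewrite big_split sumrB sumr_const card_ord.
by rewrite big_split /= sumr_const card_ord -mulrnA.
Qed.

End Cells.

Lemma sum_bool_cells (V : nmodType) k (F : bool * ('I_k * 'I_k) -> V) :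
  \sum_j F j =
  \sum_(a1 < k) \sum_(a2 < k) (F (true, (a1, a2)) + F (false, (a1, a2))).
Proof.
have pairE (I J : finType) (G : I * J -> V) :
    \sum_j G j = \sum_i \sum_j G (i, j).
  by rewrite pair_bigA; apply: eq_bigr => -[].
rewrite pairE big_bool !pairE -big_split.
by apply: eq_bigr => a1 _; rewrite -big_split.
Qed.

Lemma effective_energy0_lt eta lam eps :
  effective_energy M eta lam = 0%E -> 0 < eps ->
  exists k psi, [/\ (0 < k)%N, periodic M k psi
    & average_energy M eta lam k psi < eps].
Proof.
move=> E0 eps0.
have : (effective_energy M eta lam < eps%:E)%E by rewrite E0 lte_fin.
move=> /ereal_inf_lt[_ [k k0 <-]] /ereal_inf_lt[_ [psi psik <-]].
by rewrite lte_fin; exists k, psi.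
Qed.

Definition unit_spring (w : 'cV[R]_2 -> 'cV[R]_2) P Q : R :=
  (enorm (w P - w Q) - 1) ^+ 2.

Lemma sum_unit_spring_shift lam k psi P Q b1 b2 :
  periodic M k psi -> nodes M P -> nodes M Q ->
  let w (a1 a2 : 'I_k) x :=
    let y := x + lattice_vec M (a1 : nat)%:Z (a2 : nat)%:Z in
    lam *m y + psi y in
  \sum_(a1 < k) \sum_(a2 < k) (unit_spring (w a1 a2) P Q -
    unit_spring (w a1 a2)
      (P + lattice_vec M b1 b2) (Q + lattice_vec M b1 b2)) = 0.
Proof.
move=> psik nP nQ w; under eq_bigr => a1 _ do rewrite sumrB.
rewrite sumrB; apply/eqP; rewrite subr_eq0 eq_sym; apply/eqP.
exact: (sum_deformed_edge_shift lam psik (fun v => (enorm v - 1) ^+ 2) nP nQ).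
Qed.

(** Each cell carries two triangles, [X Y Z] and its image [X' Y' Z'] under a
    point reflection, whose corresponding vertices agree modulo the lattice.
    Hence the periodic parts cancel in the sum over all cells of the edges
    [Y - X] and [X' - Y'], and likewise for [Z - X] and [X' - Z']: the average
    of these edges is the image under [lam] of the reference edge. The list
    [swaps] holds the sides of the two triangles that are springs of another
    cell; by periodicity, moving a spring by a lattice vector does not change
    the total energy. *)
Lemma isotropic_of_effective_energy0 eta (g d m : R)
    (X Y Z X' Y' Z' : 'cV[R]_2) (bX1 bX2 bY1 bY2 bZ1 bZ2 : int)
    (swaps : seq ('cV[R]_2 * 'cV[R]_2 * int * int)) (lam : 'M[R]_2) :
    0 < d -> g ^+ 2 + d ^+ 2 = 1 -> 0 < m -> 0 < polygon_area (cell M) ->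
    nodes M X -> nodes M Y -> nodes M Z ->
    X' = X + lattice_vec M bX1 bX2 -> Y' = Y + lattice_vec M bY1 bY2 ->
    Z' = Z + lattice_vec M bZ1 bZ2 ->
    Y - X = pt 1 0 -> Z - X = pt g d -> X' - Y' = pt 1 0 -> X' - Z' = pt g d ->
    (forall P Q b1 b2, (P, Q, b1, b2) \in swaps -> nodes M P /\ nodes M Q) ->
    (forall w : 'cV[R]_2 -> 'cV[R]_2,
      triangle_defect m (pt g d) (w Y - w X) (w Z - w X) +
      triangle_defect m (pt g d) (w X' - w Y') (w X' - w Z') <=
      cell_energy M eta w + \sum_(s <- swaps) let: (P, Q, b1, b2) := s in
        (unit_spring w P Q -
         unit_spring w (P + lattice_vec M b1 b2) (Q + lattice_vec M b1 b2))) ->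
  effective_energy M eta lam = 0%E -> isotropic_compression lam.
Proof.
move=> d0 gd1 m0 U0 nX nY nZ eX eY eZ YX ZX XY XZ nodes_swaps bound E0.
apply: (isotropic_of_average_defect d0 gd1 m0) => eps eps0.
have eps'0 : 0 < 2 * eps / polygon_area (cell M).
  by rewrite divr_gt0 // mulr_gt0.
have [k [psi [k0 psik small]]] := effective_energy0_lt E0 eps'0.
pose e P Q (a : 'I_k * 'I_k) :=
  deformed_edge lam psi P Q (a.1 : nat)%:Z (a.2 : nat)%:Z.
exists (bool * ('I_k * 'I_k))%type.
exists (fun j => if j.1 then e Y X j.2 else e X' Y' j.2).
exists (fun j => if j.1 then e Z X j.2 else e X' Z' j.2).
have cardJ : #|{: bool * ('I_k * 'I_k)}| = (2 * (k * k))%N.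
  by rewrite !card_prod card_bool !card_ord.
rewrite cardJ; split.
- by rewrite !muln_gt0 k0.
- rewrite sum_bool_cells; under eq_bigr => a1 _ do rewrite big_split.
  rewrite big_split /= !sum_deformed_edge XY YX.
  rewrite (lattice_sum_shift psik nX eX) (lattice_sum_shift psik nY eY).
  by rewrite addrACA -mulrnDr mul2n addnn -[X in _ + (X + _)]opprB addNr addr0.
- rewrite sum_bool_cells; under eq_bigr => a1 _ do rewrite big_split.
  rewrite big_split /= !sum_deformed_edge XZ ZX.
  rewrite (lattice_sum_shift psik nX eX) (lattice_sum_shift psik nZ eZ).
  by rewrite addrACA -mulrnDr mul2n addnn -[X in _ + (X + _)]opprB addNr addr0.
rewrite sum_bool_cells.
pose w (a1 a2 : 'I_k) x :=
  let y := x + lattice_vec M (a1 : nat)%:Z (a2 : nat)%:Z in lam *m y + psi y.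
apply: (@le_trans _ _
  (\sum_(a1 < k) \sum_(a2 < k) cell_energy M eta (w a1 a2))).
  pose S a1 a2 := \sum_(s <- swaps) let: (P, Q, b1, b2) := s in
    (unit_spring (w a1 a2) P Q - unit_spring (w a1 a2)
        (P + lattice_vec M b1 b2) (Q + lattice_vec M b1 b2)).
  have swap0 : \sum_(a1 < k) \sum_(a2 < k) S a1 a2 = 0.
    under eq_bigr => a1 _ do rewrite exchange_big.
    rewrite exchange_big big_seq big1 //=.
    move=> [[[P Q] b1] b2] /nodes_swaps[nP nQ].
    exact: sum_unit_spring_shift.
  apply: (@le_trans _ _
      (\sum_(a1 < k) \sum_(a2 < k) (cell_energy M eta (w a1 a2) + S a1 a2))).
    by apply: ler_sum => a1 _; apply: ler_sum => a2 _; exact: bound.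
  under eq_bigr => a1 _ do rewrite big_split.
  by rewrite big_split /= swap0 addr0.
have kk0 : (0 : R) < k%:R ^+ 2 * polygon_area (cell M).
  by rewrite mulr_gt0 // exprn_gt0 // ltr0n.
move: small; rewrite /average_energy mulrC ltr_pdivrMr // => /ltW small.
apply: le_trans small _; rewrite !natrM le_eqVlt; apply/predU1P; left; field.
by rewrite lt0r_neq0.
Qed.

End Lattice.

(** * The folding mechanism *)

Section Mechanism.
Variables (R : realType) (M : metamaterial R).

Lemma polygon_area_ge0 (s : seq 'cV[R]_2) : 0 <= polygon_area s.
Proof. by rewrite divr_ge0. Qed.

Lemma penalty_ge0 (eta t : R) : 0 < eta -> 0 <= penalty eta t.
Proof.
by rewrite /penalty => eta0; case: ifP => // _; rewrite invr_ge0 ltW.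
Qed.

Lemma cell_energy_ge0 eta u : 0 < eta ->
  (forall s, s \in springs M -> 0 <= s.2) -> 0 <= cell_energy M eta u.
Proof.
move=> eta0 c0; apply: addr_ge0.
  rewrite /spring_energy big_seq sumr_ge0 // => -[[P Q] c] /c0 /= ?.
  by rewrite mulr_ge0 ?sqr_ge0.
apply: sumr_ge0 => -[[P Q] N] _.
by rewrite mulr_ge0 ?penalty_ge0 ?polygon_area_ge0.
Qed.

Lemma effective_energy_eq0 eta lam psi : 0 < eta ->
  (forall s, s \in springs M -> 0 <= s.2) ->
  periodic M 1 psi -> cell_energy M eta (fun x => lam *m x + psi x) = 0 ->
  effective_energy M eta lam = 0%E.
Proof.
move=> eta0 c0 psi1 E0; apply/eqP; rewrite eq_le; apply/andP; split.
  apply: (@le_trans _ _ (average_energy M eta lam 1 psi)%:E).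
    apply: (@le_trans _ _ (ereal_inf [set (average_energy M eta lam 1 chi)%:E
      | chi in periodic M 1]%classic)).
      by apply: ereal_inf_lbound; exists 1%N.
    by apply: ereal_inf_lbound; exists psi.
  rewrite lee_fin /average_energy !big_ord1 /shifted_cell_energy.
  rewrite /lattice_vec !mulr0z addr0.
  rewrite (_ : cell_energy _ _ _ = 0) ?mulr0 // -[RHS]E0.
  by congr cell_energy; apply: boolp.funext => x; rewrite addr0.
apply: le_ereal_inf_tmp => _ [k k0 <-]; apply: le_ereal_inf_tmp => _ [chi _ <-].
rewrite lee_fin mulr_ge0 ?invr_ge0 ?mulr_ge0 ?exprn_ge0 ?polygon_area_ge0 //.
by apply: sumr_ge0 => a1 _; apply: sumr_ge0 => a2 _; exact: cell_energy_ge0.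
Qed.

(** A 1-periodic function with values 0 at 0 and 1 at 1/2: it tells the nodes of
    a cell apart, since their lattice coordinates are half-integers. *)
Definition off_integer (t : R) : R := if t \is a Num.int then 0 else 1.

Lemma off_integerD1 t : off_integer (t + 1) = off_integer t.
Proof. by rewrite /off_integer rpredDr ?rpred1. Qed.

Lemma off_integer_half (m : int) : off_integer (m%:~R / 2) = (odd `|m|)%:R.
Proof.
rewrite /off_integer; case: intrP => [[z mz]|notz].
  have -> : m = z * 2.
    by apply: (@intr_inj R); rewrite intrM -mz divfK.
  by rewrite abszM oddM andbF.
case: (boolP (odd _)) => // ev; case: notz.
have /dvdzP[z ->] : (2 %| m)%Z by rewrite dvdzE dvdn2.
by exists z; rewrite intrM mulfK.
Qed.

(* [t1] and [t2] are meant to be the coordinates in the lattice basis. *)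
Variables t1 t2 : 'cV[R]_2 -> R.

(** The periodic displacement, up to a quarter turn, of the folding mechanism:
    it has half of each lattice vector as amplitude, so that on a rigid piece
    it equals [x] or [- x] up to a constant, according to the direction in
    which the piece turns. *)
Definition fold_field x : 'cV[R]_2 :=
  (off_integer (t2 x) / 2) *: lat2 M - (off_integer (t1 x) / 2) *: lat1 M.

Lemma fold_field_half P (m n : int) :
  t1 P = m%:~R / 2 -> t2 P = n%:~R / 2 -> fold_field P =
  ((odd `|n|)%:R / 2) *: lat2 M - ((odd `|m|)%:R / 2) *: lat1 M.
Proof. by rewrite /fold_field => -> ->; rewrite !off_integer_half. Qed.

(** With [lam = c Q] and [s ^+ 2 = 1 - c ^+ 2], add the periodic deformation
    [s Q J e], where [J] is the quarter turn and [e] the fold field.  On a piece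
    where [e] has gradient [1] or [-1] the total gradient is [Q (c + s J)] or
    [Q (c - s J)], a rotation in both cases: springs keep their lengths,
    triangles keep their orientation, and the energy is zero already for the
    period of a single cell. *)
Lemma effective_energy_isotropic eta lam : 0 < eta ->
  (forall x, t1 (x + lat1 M) = t1 x + 1 /\ t2 (x + lat1 M) = t2 x) ->
  (forall x, t1 (x + lat2 M) = t1 x /\ t2 (x + lat2 M) = t2 x + 1) ->
  (forall s, s \in springs M -> 0 <= s.2 /\ exists e : bool,
     fold_field s.1.1 - fold_field s.1.2 = (-1) ^+ e *: (s.1.1 - s.1.2)) ->
  (forall P Q N, (P, Q, N) \in penalized M -> cross (Q - P) (N - P) != 0 /\
     exists e : bool, fold_field Q - fold_field P = (-1) ^+ e *: (Q - P) /\
                      fold_field N - fold_field P = (-1) ^+ e *: (N - P)) ->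
  isotropic_compression lam -> effective_energy M eta lam = 0%E.
Proof.
move=> eta0 per1 per2 spr pen [c [Q0 [c0 c1 SO ->]]].
have [a [b [ab ->]]] := special_orthogonalP SO.
rewrite scale_similarity.
pose s := Num.sqrt (1 - c ^+ 2).
have cs : c ^+ 2 + s ^+ 2 = 1.
  by rewrite sqr_sqrtr; [ring | rewrite subr_ge0 expr_le1].
pose psi (x : 'cV[R]_2) : 'cV[R]_2 :=
  similarity (- (s * b)) (s * a) *m fold_field x.
pose u (x : 'cV[R]_2) : 'cV[R]_2 := similarity (c * a) (c * b) *m x + psi x.
pose rot (e : bool) : 'M[R]_2 :=
  similarity (c * a - (-1) ^+ e * (s * b)) (c * b + (-1) ^+ e * (s * a)).
have rotSO e : special_orthogonal (rot e).
  apply/similarity_SO.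
  rewrite (_ : _ + _ =
     (c ^+ 2 + ((-1) ^+ e) ^+ 2 * s ^+ 2) * (a ^+ 2 + b ^+ 2)); last by ring.
  by rewrite sqrr_sign mul1r cs ab mulr1.
have rotated_diff (e : bool) P Q :
    fold_field P - fold_field Q = (-1) ^+ e *: (P - Q) ->
  u P - u Q = rot e *m (P - Q).
  move=> PQ; rewrite /u opprD addrACA -!mulmxBr PQ.
  move: (P - Q) => v.
  have vZ i : ((-1) ^+ e *: v) i 0 = (-1) ^+ e * v i 0 by rewrite mxE.
  apply: ptP; rewrite col_addE.
    by rewrite !similarity_col0 !vZ; ring.
  by rewrite !similarity_col1 !vZ; ring.
have enorm_rot e v : enorm (rot e *m v) = enorm v.
  have ab1 := (similarity_SO _ _).1 (rotSO e).
  rewrite !enormE similarity_col0 similarity_col1; congr Num.sqrt.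
  by rewrite -[RHS]mul1r -[in RHS]ab1; ring.
apply: (@effective_energy_eq0 _ _ psi) => //.
- by move=> s' /spr[].
- move=> x _; rewrite /psi /fold_field !mulr1n.
  have [-> ->] := per1 x; have [-> ->] := per2 x.
  by rewrite !off_integerD1.
rewrite /cell_energy /spring_energy !big_seq !big1 ?addr0 //.
  move=> [[P Q] N] /pen[T0 [e [QP NP]]].
  rewrite /grad_interp !(rotated_diff _ _ _ QP, rotated_diff _ _ _ NP).
  rewrite -mul_mx_of_cols mulmxK.
    by rewrite (rotSO e).2 /penalty ler10 mulr0.
  by rewrite unitmxE det_mx_of_cols unitfE.
move=> [[P Q] w] /spr[_ [e /= PQ]].
by rewrite (rotated_diff _ _ _ PQ) enorm_rot subrr expr0n mulr0.
Qed.

End Mechanism.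

(** * The two lattices *)

Section Concrete.

Variable R : realType.

Lemma ptD (x y x' y' : R) : pt x y + pt x' y' = pt (x + x') (y + y').
Proof. by apply: ptP; rewrite col_addE ?pt0E ?pt1E. Qed.

Lemma ptB (x y x' y' : R) : pt x y - pt x' y' = pt (x - x') (y - y').
Proof. by apply: ptP; rewrite col_subE ?pt0E ?pt1E. Qed.

Lemma ptMz (x y : R) a : pt x y *~ a = pt (x *~ a) (y *~ a).
Proof.
apply: ptP; rewrite ?pt0E ?pt1E; case: a => n /=;
  by rewrite ?NegzE ?mulrNz -?pmulrn ?[in LHS]mxE mulmxnE ?pt0E ?pt1E.
Qed.

Lemma ptZ (c x y : R) : c *: pt x y = pt (c * x) (c * y).
Proof. by apply: ptP; rewrite [LHS]mxE ?pt0E ?pt1E. Qed.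

Lemma enorm_pt (x y : R) : enorm (pt x y) = Num.sqrt (x ^+ 2 + y ^+ 2).
Proof. by rewrite enormE pt0E pt1E. Qed.

Lemma enorm_pt1 (x y : R) : x ^+ 2 + y ^+ 2 = 1 -> enorm (pt x y) = 1.
Proof. by rewrite enorm_pt => ->; rewrite sqrtr1. Qed.

Lemma cross_pt (x y x' y' : R) : cross (pt x y) (pt x' y') = x * y' - y * x'.
Proof. by rewrite /cross !pt0E !pt1E. Qed.

Lemma crossC (v w : 'cV[R]_2) : cross v w = - cross w v.
Proof. by rewrite /cross; ring. Qed.

Lemma crossNN (v w : 'cV[R]_2) : cross (- v) (- w) = cross v w.
Proof.
have N i (z : 'cV[R]_2) : (- z) i 0 = - z i 0 by rewrite mxE.
by rewrite /cross !N !mulrNN.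
Qed.

Lemma polygon_area3 (P Q N : 'cV[R]_2) :
  polygon_area [:: P; Q; N] = `|cross P Q + cross Q N + cross N P| / 2.
Proof.
rewrite /polygon_area -!det_mx_of_cols; congr (`|_| / 2).
rewrite -(big_mkord xpredT (fun i => \det (mx_of_cols [:: P; Q; N]`_i
  [:: P; Q; N]`_(i.+1 %% size [:: P; Q; N])))).
by rewrite /index_iota /= !big_cons big_nil addr0 !addrA.
Qed.

Lemma polygon_area4 (P Q N S : 'cV[R]_2) : polygon_area [:: P; Q; N; S] =
  `|cross P Q + cross Q N + cross N S + cross S P| / 2.
Proof.
rewrite /polygon_area -!det_mx_of_cols; congr (`|_| / 2).
rewrite -(big_mkord xpredT (fun i => \det (mx_of_cols [:: P; Q; N; S]`_i
  [:: P; Q; N; S]`_(i.+1 %% size [:: P; Q; N; S])))).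
by rewrite /index_iota /= !big_cons big_nil addr0 !addrA.
Qed.

Lemma sub_subl (V : zmodType) (x y z : V) : (x - z) - (x - y) = y - z.
Proof. by rewrite opprB addrC addrA subrK. Qed.

Lemma sub_subr (V : zmodType) (x y z : V) : (x - z) - (y - z) = x - y.
Proof. by rewrite opprB addrA subrK. Qed.

Lemma area_penalty (a eta x c : R) : 0 < c ->
  a * penalty eta (x / c) = if x <= 0 then a / eta else 0.
Proof.
move=> c0; rewrite /penalty ler_pdivrMr // mul0r.
by case: ifP => _; rewrite ?mulr0.
Qed.

Let h : R := Num.sqrt 3 / 2.

Lemma sqr_sqrt3 : Num.sqrt 3 ^+ 2 = 3 :> R.
Proof. by rewrite sqr_sqrtr. Qed.

Lemma sqrt3_gt0 : 0 < Num.sqrt 3 :> R.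
Proof. by rewrite sqrtr_gt0. Qed.

Lemma sqr_kagome_height : h ^+ 2 = 3 / 4.
Proof. by rewrite /h expr_div_n sqr_sqrt3; field. Qed.

Lemma kagome_height_gt0 : 0 < h.
Proof. by rewrite divr_gt0 ?sqrt3_gt0. Qed.

Lemma kagome_lattice a1 a2 : lattice_vec (kagome R) a1 a2 =
  pt (a1%:~R * 2 + a2%:~R) (a2%:~R * Num.sqrt 3).
Proof.
rewrite /lattice_vec /= !ptMz ptD mul0rz add0r -[2 *~ _]mulrzl.
by rewrite -[Num.sqrt 3 *~ _]mulrzl.
Qed.

(** The triangles [C D O] and [A B O] have the sides [C D] and [A B] that are
    not springs of the cell; their lattice translates [A F] and [E D] are. *)
Lemma kagome_cell_energy eta (w : 'cV[R]_2 -> 'cV[R]_2) :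
  let O := w (pt 0 0) in
  let A := w (pt (1 / 2) h) in
  let B := w (pt (- (1 / 2)) h) in
  let C := w (pt (- (1 / 2)) (- h)) in
  let D := w (pt (1 / 2) (- h)) in
  let E := w (pt (3 / 2) (- h)) in
  let F := w (pt (3 / 2) h) in
  let td := triangle_defect (h / 2 / eta) (pt (1 / 2) h) in
  cell_energy (kagome R) eta w = td (D - C) (O - C) + td (A - B) (A - O)
    + ((enorm (A - F) - 1) ^+ 2 - (enorm (C - D) - 1) ^+ 2)
    + ((enorm (D - E) - 1) ^+ 2 - (enorm (B - A) - 1) ^+ 2).
Proof.
move=> O A B C D E F td.
have h2 := sqr_kagome_height; have h0 := kagome_height_gt0.
rewrite /cell_energy /spring_energy /= !big_cons !big_nil.
rewrite /triangle_area !polygon_area3 !det_grad_interp !ptB !cross_pt -/h.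
rewrite -/O -/A -/B -/C -/D -/E -/F /td /triangle_defect ptB.
rewrite !enorm_pt1; try lra.
rewrite (_ : 1 / 2 * 0 - h * 0 + _ + _ = - h); last by field.
rewrite (_ : - (1 / 2) * 0 - - h * 0 + _ + _ = - h); last by field.
rewrite (_ : (0 - 1 / 2) * (h - h) - _ = - h); last by field.
rewrite (_ : (0 - - (1 / 2)) * (- h - - h) - _ = - h); last by field.
rewrite sub_subl sub_subr normrN (gtr0_norm h0) invrN !mulrN -!mulNr -!crossC.
rewrite -[cross (B - A) _]crossNN (opprB B) (opprB O) !(area_penalty _ _ _ h0).
rewrite (enormB C O) (enormB C D) (enormB D O) (enormB B A).
by do 2![move: (if cross _ _ <= 0 then _ else _) => ?]; ring.
Qed.

Lemma kagome_soft_modes eta lam : 0 < eta ->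
  effective_energy (kagome R) eta lam = 0%E -> isotropic_compression lam.
Proof.
move=> eta0; have h2 := sqr_kagome_height; have h0 := kagome_height_gt0.
pose O : 'cV[R]_2 := pt 0 0; pose A := pt (1 / 2) h; pose B := pt (- (1 / 2)) h.
pose C := pt (- (1 / 2)) (- h); pose D := pt (1 / 2) (- h).
pose E := pt (3 / 2) (- h); pose F := pt (3 / 2) h.
have lat (x y x' y' : R) a1 a2 : x' = x + a1%:~R * 2 + a2%:~R ->
    y' = y + a2%:~R * (2 * h) ->
    pt x' y' = pt x y + lattice_vec (kagome R) a1 a2.
  move=> -> ->; rewrite kagome_lattice ptD addrA.
  by rewrite (_ : Num.sqrt 3 = 2 * h) //; rewrite /h; field.
have CA : A = C + lattice_vec (kagome R) 0 1 by apply: lat; lra.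
have DB : B = D + lattice_vec (kagome R) (-1) 1 by apply: lat; lra.
have DF : F = D + lattice_vec (kagome R) 0 1 by apply: lat; lra.
have BD : D = B + lattice_vec (kagome R) 1 (-1) by apply: lat; lra.
have AE : E = A + lattice_vec (kagome R) 1 (-1) by apply: lat; lra.
have zero P : P = P + lattice_vec (kagome R) 0 0.
  by rewrite /lattice_vec !mulr0z !addr0.
have basic v : v \in basic_nodes (kagome R) -> nodes (kagome R) v.
  by move=> vM; exists v, 0, 0; split=> //; exact: zero.
have nO : nodes (kagome R) O by apply: basic; rewrite !inE eqxx orbT.
have nD : nodes (kagome R) D by apply: basic; rewrite !inE eqxx !orbT.
have nA : nodes (kagome R) A by apply: basic; rewrite !inE eqxx.
have nB : nodes (kagome R) B by rewrite DB; exact: nodes_shift.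
have nC : nodes (kagome R) C.
  have -> : C = A + lattice_vec (kagome R) 0 (-1) by apply: lat; lra.
  exact: nodes_shift.
(* The swaps move [C D] to [A F] and [B A] to [D E]. *)
apply: (isotropic_of_effective_energy0 (g := 1 / 2) (d := h) (m := h / 2 / eta)
  (swaps := [:: (C, D, 0, 1); (B, A, 1, -1)]) _ _ _ _ nC nD nO CA DB (zero O)).
- exact: h0.
- by rewrite h2; lra.
- by rewrite !divr_gt0.
- rewrite polygon_area4 !cross_pt divr_gt0 // normr_gt0.
  by rewrite -/h; apply: lt0r_neq0; nra.
1-4: by rewrite ptB; congr pt; field.
- by move=> P Q b1 b2; rewrite !inE => /orP[] /eqP[-> -> _ _].
move=> w; rewrite kagome_cell_energy !big_cons big_nil addr0 -CA -DF -BD -AE.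
rewrite /unit_spring -/O -/A -/B -/C -/D -/E -/F; lra.
Qed.

Lemma rotating_squares_lattice a1 a2 :
  lattice_vec (rotating_squares R) a1 a2 = pt (a1%:~R * 2) (a2%:~R * 2).
Proof.
by rewrite /lattice_vec /= !ptMz ptD !mul0rz add0r addr0 -![2 *~ _]mulrzl.
Qed.

Lemma rotating_squares_soft_modes eta lam : 0 < eta ->
  effective_energy (rotating_squares R) eta lam = 0%E ->
  isotropic_compression lam.
Proof.
move=> eta0; set M := rotating_squares R.
pose O : 'cV[R]_2 := pt 0 0; pose A : 'cV[R]_2 := pt (-1) 1.
pose B : 'cV[R]_2 := pt 0 1; pose C : 'cV[R]_2 := pt 1 1.
pose D : 'cV[R]_2 := pt (-1) 0; pose E : 'cV[R]_2 := pt 1 0.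
pose F : 'cV[R]_2 := pt (-1) (-1); pose G : 'cV[R]_2 := pt 0 (-1).
pose H : 'cV[R]_2 := pt 1 (-1).
have lat (x y x' y' : R) a1 a2 : x' = x + a1%:~R * 2 ->
    y' = y + a2%:~R * 2 -> pt x' y' = pt x y + lattice_vec M a1 a2.
  by move=> -> ->; rewrite rotating_squares_lattice ptD.
have DE : E = D + lattice_vec M 1 0 by apply: lat; lra.
have AH : H = A + lattice_vec M 1 (-1) by apply: lat; lra.
have ED : D = E + lattice_vec M (-1) 0 by apply: lat; lra.
have HF : F = H + lattice_vec M (-1) 0 by apply: lat; lra.
have zero P : P = P + lattice_vec M 0 0.
  by rewrite /lattice_vec !mulr0z !addr0.
have basic v : v \in basic_nodes M -> nodes M v.
  by move=> vM; exists v, 0, 0; split=> //; exact: zero.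
have nO : nodes M O by apply: basic; rewrite !inE eqxx.
have nD : nodes M D by apply: basic; rewrite !inE eqxx !orbT.
have nA : nodes M A by apply: basic; rewrite !inE eqxx orbT.
have nE : nodes M E by rewrite DE; exact: nodes_shift.
have nH : nodes M H by rewrite AH; exact: nodes_shift.
(* One triangle of each square is enough; the swap moves [E H] to [D F]. *)
apply: (isotropic_of_effective_energy0 (g := 0) (d := 1) (m := 2^-1 / eta)
  (swaps := [:: (E, H, -1, 0)]) _ _ _ _ nD nO nA DE (zero O) AH).
- exact: ltr01.
- by rewrite expr0n expr1n add0r.
- by rewrite divr_gt0.
- rewrite polygon_area4 !cross_pt divr_gt0 // normr_gt0.
  by apply: ltr0_neq0; lra.
1-4: by rewrite ptB; congr pt; ring.
- by move=> P Q b1 b2; rewrite !inE => /eqP[-> -> _ _].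
move=> w; rewrite big_seq1 -ED -HF /unit_spring.
rewrite /cell_energy /spring_energy /= !big_cons !big_nil.
rewrite -/O -/A -/B -/C -/D -/E -/F -/G -/H.
have pen_ge0 T : 0 <= triangle_area T * penalty eta (\det (grad_interp w T)).
  by case: T => [[P Q] N]; rewrite mulr_ge0 ?penalty_ge0 ?polygon_area_ge0.
have penAOD :
    triangle_area (A, O, D) * penalty eta (\det (grad_interp w (A, O, D))) =
    if cross (w O - w D) (w A - w D) <= 0 then 2^-1 / eta else 0.
  rewrite /triangle_area polygon_area3 det_grad_interp !ptB !cross_pt.
  rewrite -(area_penalty 2^-1 eta _ ltr01); congr (_ * penalty _ _).
    by rewrite [X in `|X|](_ : _ = -1) ?normrN1 ?mul1r //; ring.
  by rewrite /cross !col_subE; field; lra.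
have penEOH :
    triangle_area (E, O, H) * penalty eta (\det (grad_interp w (E, O, H))) =
    if cross (w E - w O) (w E - w H) <= 0 then 2^-1 / eta else 0.
  rewrite /triangle_area polygon_area3 det_grad_interp !ptB !cross_pt.
  rewrite -(area_penalty 2^-1 eta _ ltr01); congr (_ * penalty _ _).
    by rewrite [X in `|X|](_ : _ = 1) ?normr1 ?mul1r //; ring.
  by rewrite /cross !col_subE; field; lra.
have := pen_ge0 (A, O, B); have := pen_ge0 (G, O, H).
rewrite penAOD penEOH {pen_ge0 penAOD penEOH} /triangle_defect.
rewrite sub_subl sub_subr.
move: (triangle_area _ * _) (triangle_area _ * _) => pAOB pGOH pAOB0 pGOH0.
do 2![move: (if cross _ _ <= 0 then _ else _) => ?].
(* Both diagonals are parallel to [B - E], the third side of the reference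
   triangle. *)
have -> : enorm (A - O) = enorm (B - E).
  by rewrite !ptB; congr (enorm (pt _ _)); ring.
have -> : enorm (O - H) = enorm (B - E).
  by rewrite !ptB; congr (enorm (pt _ _)); ring.
rewrite (enormB (w O) (w D)).
have [-> -> -> ->] : [/\ enorm (A - D) = 1, enorm (D - O) = 1,
    enorm (E - O) = 1 & enorm (D - F) = 1].
  by split; rewrite ptB; apply: enorm_pt1; ring.
have sq x := sqr_ge0 (x : R).
have := sq (enorm (w A - w B) - enorm (A - B)).
have := sq (enorm (w B - w C) - enorm (B - C)).
have := sq (enorm (w B - w O) - enorm (B - O)).
have := sq (enorm (w O - w G) - enorm (O - G)).
have := sq (enorm (w A - w O) - enorm (B - E)).
have := sq (enorm (w O - w H) - enorm (B - E)).
clear -pAOB0 pGOH0; lra.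
Qed.

Lemma kagome_mechanism eta lam : 0 < eta -> isotropic_compression lam ->
  effective_energy (kagome R) eta lam = 0%E.
Proof.
move=> eta0; have h0 := kagome_height_gt0; have hn0 := lt0r_neq0 h0.
have s3h : Num.sqrt 3 = 2 * h by rewrite /h; field.
pose t2 (x : 'cV[R]_2) := x 1 0 / (2 * h).
pose t1 (x : 'cV[R]_2) := (x 0 0 - x 1 0 / (2 * h)) / 2.
(* The integers [m] and [n] are twice the lattice coordinates. *)
have foldE (x y : R) m n : x = m%:~R + n%:~R / 2 -> y = n%:~R * h ->
    fold_field (kagome R) t1 t2 (pt x y) =
    pt ((odd `|n|)%:R / 2 - (odd `|m|)%:R) ((odd `|n|)%:R * h).
  move=> ex ey; rewrite (@fold_field_half _ _ _ _ _ m n).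
  - by rewrite /= s3h !ptZ ptB; congr pt; field.
  - by rewrite /t1 pt0E pt1E ex ey; field.
  - by rewrite /t2 pt1E ey; field.
have fO : fold_field (kagome R) t1 t2 (pt 0 0) = pt 0 0.
  by rewrite (foldE _ _ 0 0) /=; [congr pt; ring | ring | ring].
have fA : fold_field (kagome R) t1 t2 (pt (1 / 2) h) = pt (1 / 2) h.
  by rewrite (foldE _ _ 0 1) /=; [congr pt; ring | ring | ring].
have fB : fold_field (kagome R) t1 t2 (pt (- (1 / 2)) h) = pt (- (1 / 2)) h.
  by rewrite (foldE _ _ (-1) 1) /=; [congr pt; field | field | ring].
have fC : fold_field (kagome R) t1 t2 (pt (- (1 / 2)) (- h)) = pt (1 / 2) h.
  by rewrite (foldE _ _ 0 (-1)) /=; [congr pt; ring | field | ring].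
have fD : fold_field (kagome R) t1 t2 (pt (1 / 2) (- h)) = pt (- (1 / 2)) h.
  by rewrite (foldE _ _ 1 (-1)) /=; [congr pt; field | field | ring].
have fE : fold_field (kagome R) t1 t2 (pt (3 / 2) (- h)) = pt (1 / 2) h.
  by rewrite (foldE _ _ 2 (-1)) /=; [congr pt; ring | field | ring].
have fF : fold_field (kagome R) t1 t2 (pt (3 / 2) h) = pt (- (1 / 2)) h.
  by rewrite (foldE _ _ 1 1) /=; [congr pt; field | field | ring].
apply: (@effective_energy_isotropic _ _ t1 t2) => //.
- by move=> x; rewrite /t1 /t2 !col_addE !pt0E !pt1E; split; field.
- by move=> x; rewrite /t1 /t2 !col_addE !pt0E !pt1E s3h; split; field.
(* The sign says whether the spring turns with the triangle [A O B] or with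
   [C O D]. *)
- move=> s; rewrite /= !inE -/h => /or4P[|||/or3P[]] /eqP-> /=;
    (split; first exact: ler01);
    [exists false | exists false | exists true
    | exists true | exists true | exists false];
    by rewrite ?(fO, fA, fB, fC, fD, fE, fF) !ptB ptZ; congr pt; field.
move=> P Q N; rewrite /= !inE -/h => /orP[] /eqP[-> -> ->]; split.
- by rewrite !ptB cross_pt; apply: ltr0_neq0; lra.
- by exists false; rewrite ?(fO, fA, fB) !ptB !ptZ; split; congr pt; field.
- by rewrite !ptB cross_pt; apply: ltr0_neq0; lra.
- by exists true; rewrite ?(fO, fC, fD) !ptB !ptZ; split; congr pt; field.
Qed.

Lemma rotating_squares_mechanism eta lam :
  0 < eta -> isotropic_compression lam ->
  effective_energy (rotating_squares R) eta lam = 0%E.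
Proof.
move=> eta0.
pose t1 (x : 'cV[R]_2) := x 0 0 / 2.
pose t2 (x : 'cV[R]_2) := x 1 0 / 2.
have foldE (x y : R) (m n : int) : x = m%:~R -> y = n%:~R ->
    fold_field (rotating_squares R) t1 t2 (pt x y) =
    pt (- (odd `|m|)%:R) (odd `|n|)%:R.
  move=> -> ->; rewrite (@fold_field_half _ _ _ _ _ m n) /t1 /t2 ?pt0E ?pt1E //.
  by rewrite /= !ptZ ptB; congr pt; field.
have fA : fold_field (rotating_squares R) t1 t2 (pt (-1) 1) = pt (-1) 1.
  by rewrite (foldE _ _ (-1) 1) //= ?oppr0.
have fB : fold_field (rotating_squares R) t1 t2 (pt 0 1) = pt 0 1.
  by rewrite (foldE _ _ 0 1) //= ?oppr0.
have fC : fold_field (rotating_squares R) t1 t2 (pt 1 1) = pt (-1) 1.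
  by rewrite (foldE _ _ 1 1) //= ?oppr0.
have fD : fold_field (rotating_squares R) t1 t2 (pt (-1) 0) = pt (-1) 0.
  by rewrite (foldE _ _ (-1) 0) //= ?oppr0.
have fO : fold_field (rotating_squares R) t1 t2 (pt 0 0) = pt 0 0.
  by rewrite (foldE _ _ 0 0) //= ?oppr0.
have fE : fold_field (rotating_squares R) t1 t2 (pt 1 0) = pt (-1) 0.
  by rewrite (foldE _ _ 1 0) //= ?oppr0.
have fF : fold_field (rotating_squares R) t1 t2 (pt (-1) (-1)) = pt (-1) 1.
  by rewrite (foldE _ _ (-1) (-1)) //= ?oppr0.
have fG : fold_field (rotating_squares R) t1 t2 (pt 0 (-1)) = pt 0 1.
  by rewrite (foldE _ _ 0 (-1)) //= ?oppr0.
have fH : fold_field (rotating_squares R) t1 t2 (pt 1 (-1)) = pt (-1) 1.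
  by rewrite (foldE _ _ 1 (-1)) //= ?oppr0.
apply: (@effective_energy_isotropic _ _ t1 t2) => //.
- by move=> x; rewrite /t1 /t2 !col_addE !pt0E !pt1E; split; field.
- by move=> x; rewrite /t1 /t2 !col_addE !pt0E !pt1E; split; field.
(* The sign says whether the spring turns with the square [A B O D] or with its
   neighbours. *)
- move=> s; rewrite /= !inE => /or4P[|||/or4P[|||/or4P[]]] /eqP-> /=;
    (split; first by [exact: ler01 | exact: ler0n]);
    [exists false | exists false | exists false | exists true | exists false
    | exists false | exists true | exists true | exists true | exists true];
    by rewrite ?(fA, fB, fC, fD, fO, fE, fF, fG, fH) !ptB ptZ; congr pt; ring.
move=> P Q N; rewrite /= !inE => /or4P[] /eqP[-> -> ->]; split.
- by rewrite !ptB cross_pt; apply: lt0r_neq0; lra.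
- by exists false; rewrite ?(fO, fA, fB) !ptB !ptZ; split; congr pt; ring.
- by rewrite !ptB cross_pt; apply: ltr0_neq0; lra.
- by exists false; rewrite ?(fO, fA, fD) !ptB !ptZ; split; congr pt; ring.
- by rewrite !ptB cross_pt; apply: lt0r_neq0; lra.
- by exists true; rewrite ?(fO, fE, fH) !ptB !ptZ; split; congr pt; ring.
- by rewrite !ptB cross_pt; apply: ltr0_neq0; lra.
- by exists true; rewrite ?(fO, fG, fH) !ptB !ptZ; split; congr pt; ring.
Qed.

End Concrete.

Theorem proposition2p6 (R : realType) :
  (exists eta0 : R, 0 < eta0 /\
     forall eta : R, 0 < eta -> eta < eta0 -> forall lam : 'M[R]_2,
       effective_energy (kagome R) eta lam = 0%E <-> isotropic_compression lam)
  /\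
  (exists eta0 : R, 0 < eta0 /\
     forall eta : R, 0 < eta -> eta < eta0 -> forall lam : 'M[R]_2,
       effective_energy (rotating_squares R) eta lam = 0%E <->
       isotropic_compression lam).
Proof.
split; exists 1; split; first exact: ltr01.
- move=> eta eta0 _ lam; split; first exact: kagome_soft_modes.
  exact: kagome_mechanism.
- exact: ltr01.
- move=> eta eta0 _ lam; split; first exact: rotating_squares_soft_modes.
  exact: rotating_squares_mechanism.
Qed.
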